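(* Let $r\ge 2$ be an integer and let $\varepsilon>0$. There is a constant $C=C(\varepsilon,r)>0$ such that for every integer $t$ with $2\le t\le r$ there is an $n_0\in\mathbb{N}$ such that the following holds: if $G$ is a graph on $n\ge n_0$ vertices and $$k_t(G)\ge (1+\varepsilon)\,k_t(T(n,r)),$$ then $G$ contains $K_{r+1}(b)$ as a subgraph for some integer $b\ge C\log n$.
   Context: Graphs are finite and simple. $k_t(G)$ denotes the number of copies of the complete graph $K_t$ in $G$. $T(n,r)$ is the $r$-partite Turán graph on $n$ vertices (the complete $r$-partite graph on $n$ vertices whose part sizes differ by at most one). For a graph $H$ and positive integer $b$, the blowup $H(b)$ is the graph obtained by replacing each vertex of $H$ by an independent set of size $b$ and each edge of $H$ by a complete bipartite graph; so $K_{r+1}(b)$ is the complete $(r+1)$-partite graph with all parts of size $b$. ''Contains'' means contains as a (not necessarily induced) subgraph. *)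

(* Defs.v *)
From mathcomp Require Import all_boot.

Set Implicit Arguments.
Unset Strict Implicit.
Unset Printing Implicit Defensive.

Record sgraph (V : finType) := SGraph {
  adj : rel V;
  adj_sym : symmetric adj;
  adj_irr : irreflexive adj
}.

Definition clique (V : finType) (G : sgraph V) (S : {set V}) : bool :=
  [forall x in S, forall y in S, (x != y) ==> adj G x y].

(* Copies of K_t are unlabelled: each is identified with its vertex set. *)
Definition kcount (V : finType) (t : nat) (G : sgraph V) : nat :=
  #|[set S : {set V} | (#|S| == t) && clique G S]|.

(* Subgraph containment, not necessarily induced: only edges are preserved. *)
Definition contains (V W : finType) (G : sgraph V) (H : sgraph W) : Prop :=
  exists2 f : W -> V, injective f & forall x y, adj H x y -> adj G (f x) (f y).

Section Complete.
Variable m : nat.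
Definition complete_rel : rel 'I_m := fun x y => x != y.
Lemma complete_sym : symmetric complete_rel.
Proof. by move=> x y; rewrite /complete_rel eq_sym. Qed.
Lemma complete_irr : irreflexive complete_rel.
Proof. by move=> x; rewrite /complete_rel eqxx. Qed.
Definition complete_graph : sgraph 'I_m := SGraph complete_sym complete_irr.
End Complete.

Section Blowup.
Variables (V : finType) (H : sgraph V) (b : nat).
Definition blowup_rel : rel (V * 'I_b) := fun p q => adj H p.1 q.1.
Lemma blowup_sym : symmetric blowup_rel.
Proof. by move=> p q; rewrite /blowup_rel adj_sym. Qed.
Lemma blowup_irr : irreflexive blowup_rel.
Proof. by move=> p; rewrite /blowup_rel adj_irr. Qed.
Definition blowup : sgraph (V * 'I_b)%type := SGraph blowup_sym blowup_irr.
End Blowup.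

(* The r parts are the residue classes modulo r (for r > 0); the balance
   condition on their sizes is [turan_part_balanced] below. *)
Section Turan.
Variables (n r : nat).
Definition turan_rel : rel 'I_n := fun i j => i %% r != j %% r.
Lemma turan_sym : symmetric turan_rel.
Proof. by move=> x y; rewrite /turan_rel eq_sym. Qed.
Lemma turan_irr : irreflexive turan_rel.
Proof. by move=> x; rewrite /turan_rel eqxx. Qed.
Definition turan_graph : sgraph 'I_n := SGraph turan_sym turan_irr.

Definition turan_part (c : 'I_r) : {set 'I_n} := [set i : 'I_n | i %% r == c].
End Turan.

Lemma card_turan_part (n r : nat) (c : 'I_r) :
  #|turan_part n c| = n %/ r + (c < n %% r).
Proof.
have r0 : 0 < r by apply: leq_ltn_trans (ltn_ord c).
have -> : #|turan_part n c| = \sum_(i < n) (i %% r == c).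
  by rewrite -sum1dep_card big_mkcond /=; apply: eq_bigr => i _; case: eqP.
elim: n => [|n IHn]; first by rewrite big_ord0 div0n mod0n.
rewrite big_ord_recr /= IHn [in RHS](divn_eq n r) -addnS.
rewrite divnMDl // modnMDl -!addnA; congr (_ + _).
have := ltn_pmod n r0; rewrite leq_eqVlt => /predU1P[nr|nr].
  have : c <= n %% r by rewrite -ltnS nr.
  by rewrite nr divnn modnn r0 ltn0 addn0; case: ltngtP.
by rewrite (divn_small nr) (modn_small nr) ltnS; case: ltngtP.
Qed.

Lemma turan_part_balanced (n r : nat) (c d : 'I_r) :
  #|turan_part n c| <= #|turan_part n d| + 1.
Proof.
by rewrite !card_turan_part -addnA leq_add2l; case: (c < _); case: (d < _).
Qed.

(* Main.v *)
Require Import Defs.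
From mathcomp Require Import all_boot all_order all_algebra.
From mathcomp Require Import zify ring lra.
From mathcomp Require Import reals sequences exp.

(** The proof has two independent halves: the density of K_t forces a positive
density of K_(r+1), and a positive density of K_s forces a logarithmic blowup
of K_s.

Supersaturation.  Write h_s for the number of ordered s-cliques of a graph on
N vertices.  The Moon-Moser inequality [moon_moser],
  (s+1) h_(s+1)^2 <= h_s (N h_(s+1) + s h_(s+2)),
says that if h_(s+1) / h_s >= N (1 - s a) for some slope a and some s > 0, then
the same bound, with the same a, holds at s+1.  The slope a = 1/r is the one of
the Turan graph, where h_(s+1) / h_s is about N (1 - s/r).  If a is slightly
smaller than 1/r, then for large N the product N^t prod_(s < t) (1 - s a) is
still below (1 + eps) h_t(T(N,r)), so in a graph as in the theorem the bound
with slope a cannot fail for every 0 < s < t; it therefore holds for every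
s >= t, in particular for s = r, where 1 - r a is a positive constant.
Multiplying the ratios from t to r gives h_(r+1) >= (c N)^(r+1), see
[many_cliques].

Blowups (Nikiforov).  By induction on s, a set M of clique s-tuples with
N^s <= k |M| contains, as soon as 2^(L b) <= N for a constant L = L(s, k), b
members whose i-th entries, for the various i, are the parts of a K_s(b).  For
the inductive step, the (s-1)-tuples with at least N/2k extensions in M are
dense, and give such a family of B = 4kb of them.  Every vertex has a trace on
this family, the set of members that it extends; many vertices have a trace of
size at least b, there are only 2^B traces, and so b vertices share one.  They
form the new part, and the old parts are restricted to that trace.  That the
members of the family lie in M is what makes the induction work: it ties the
parts found so far to the tuples that have many extensions.  As B depends
linearly on b, the condition on N remains exponential in b and b can be
taken of order log N, see [blowup_of_dense_tuples]. *)

Import Order.TTheory GRing.Theory Num.Theory.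

Set Implicit Arguments.
Unset Strict Implicit.
Unset Printing Implicit Defensive.

(** * The Moon-Moser inequality *)

Section MoonMoser.
Variables (V : finType) (G : sgraph V).
Implicit Types (A C : {set V}) (v : V).

Definition cliques (s : nat) : {set {set V}} :=
  [set S : {set V} | (#|S| == s) && clique G S].

Definition common_nbrs (C : {set V}) : {set V} :=
  [set v | [forall c in C, adj G c v]].

(** Counting each clique once for each of its orderings removes the binomial
factors from the recursion between consecutive clique numbers. *)
Definition ordered_cliques (s : nat) : nat := s`! * kcount s G.

Lemma common_nbrsP C v :
  reflect (forall c, c \in C -> adj G c v) (v \in common_nbrs C).
Proof. by rewrite inE; apply: (iffP forall_inP). Qed.

Lemma common_nbrs_notin C v : v \in common_nbrs C -> v \notin C.
Proof.
by move=> /common_nbrsP vC; apply/negP => /vC; rewrite adj_irr.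
Qed.

Lemma cliqueP (S : {set V}) :
  reflect (forall x y, x \in S -> y \in S -> x != y -> adj G x y) (clique G S).
Proof.
apply: (iffP forall_inP) => [cS x y xS yS | cS x xS].
  by move/forall_inP: (cS x xS) => /(_ y yS)/implyP.
by apply/forall_inP => y yS; apply/implyP; apply: cS.
Qed.

Lemma clique_setU1 C v : v \notin C ->
  clique G (v |: C) = clique G C && (v \in common_nbrs C).
Proof.
move=> vC; apply/cliqueP/andP => [cl | [/cliqueP cC /common_nbrsP vN]].
  split; first by apply/cliqueP => x y xC yC; apply: cl;
    rewrite !inE ?xC ?yC orbT.
  apply/common_nbrsP => c cC; apply: cl; rewrite ?inE ?eqxx ?cC ?orbT //.
  by apply: contraNneq vC => <-.
move=> x y /setU1P[-> | xC] /setU1P[-> | yC]; rewrite ?eqxx //.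
- by rewrite adj_sym vN.
- by rewrite vN.
- exact: cC.
Qed.

(** Double counting: a clique with a marked vertex is the same as a clique one
smaller, together with one of its common neighbours. *)
Lemma sum_facets s (f : {set V} -> V -> nat) :
  \sum_(A in cliques s.+1) \sum_(a in A) f (A :\ a) a =
  \sum_(C in cliques s) \sum_(v in common_nbrs C) f C v.
Proof.
rewrite !pair_big_dep /=.
rewrite (reindex_onto (fun p : {set V} * V => (p.2 |: p.1, p.2))
                      (fun p : {set V} * V => (p.1 :\ p.2, p.2))) /=; last first.
  by move=> [A a] /= /andP[_ aA]; rewrite setD1K.
apply: eq_big => [[C v] | [C v]] /=.
  rewrite setU11 andbT xpair_eqE eqxx andbT !inE.
  have [vC | vC] := boolP (v \in C).
    have -> : ((v |: C) :\ v == C) = false.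
      by apply/negP => /eqP E; move: vC; rewrite -E !inE eqxx.
    rewrite andbF; apply/esym/negP => /andP[_ vN].
    by have := @common_nbrs_notin C v; rewrite inE vN vC => /(_ isT).
  rewrite setU1K // eqxx andbT cardsU1 vC add1n eqSS clique_setU1 // inE.
  by rewrite andbA.
by case/andP=> _ /eqP[->].
Qed.

Lemma sum_degree_cliques s :
  \sum_(C in cliques s) #|common_nbrs C| = s.+1 * kcount s.+1 G.
Proof.
under eq_bigr do rewrite -sum1_card.
rewrite -sum_facets (eq_bigr (fun=> s.+1)) => [|A].
  by rewrite sum_nat_const mulnC.
by rewrite sum1_card inE => /andP[/eqP].
Qed.

(** A common neighbour v of A counts once for each of the s+1 facets of A.  Any
other v counts at most once: v is not adjacent to some a in A (possibly v = a),
and then A :\ a is the only facet that v can extend. *)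
Lemma sum_facet_degrees s A : A \in cliques s.+1 ->
  \sum_(a in A) #|common_nbrs (A :\ a)| <= #|V| + s * #|common_nbrs A|.
Proof.
rewrite inE => /andP[/eqP sA _].
under eq_bigr do rewrite -sum1_card big_mkcond /=.
rewrite exchange_big /= -sum1_card -[#|common_nbrs A|]sum1_card.
rewrite big_distrr /= [in X in _ + X]big_mkcond -big_split /=.
apply: leq_sum => v _; rewrite -big_mkcondr sum1dep_card.
have [vA | vA] := boolP (v \in common_nbrs A).
  rewrite muln1 add1n -sA subset_leq_card //.
  by apply/subsetP => a; rewrite inE => /andP[].
rewrite addn0; apply/card_le1_eqP => a b.
rewrite !inE => /andP[aA /forall_inP va] /andP[bA /forall_inP vb].
apply/eqP; apply: contraNT vA => ab; apply/common_nbrsP => c cA.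
have [cea | ca] := eqVneq c a.
  by apply: vb; rewrite !inE cA cea eq_sym ab.
by apply: va; rewrite !inE cA ca.
Qed.

Lemma sum_sqr_leq (I : finType) (P : {set I}) (d : I -> nat) :
  (\sum_(i in P) d i) ^ 2 <= #|P| * \sum_(i in P) d i ^ 2.
Proof.
rewrite -(leq_pmul2l (isT : 0 < 2)).
rewrite -mulnn big_distrlr /= big_distrr /=.
apply: (@leq_trans (\sum_(i in P) \sum_(j in P) (d i ^ 2 + d j ^ 2))).
  apply: leq_sum => i _; rewrite big_distrr leq_sum // => j _.
  exact: nat_Cauchy.
under eq_bigr do rewrite big_split /= sum_nat_const.
by rewrite big_split /= -big_distrr sum_nat_const /= mul2n addnn.
Qed.

(** The sum over the s-cliques C of the squared degrees is bounded below by
Cauchy-Schwarz and above by [sum_facet_degrees], because it is also the sum,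
over the (s+1)-cliques, of the degrees of their facets. *)
Lemma moon_moser s :
  s.+1 * ordered_cliques s.+1 ^ 2 <=
  ordered_cliques s * (#|V| * ordered_cliques s.+1 + s * ordered_cliques s.+2).
Proof.
have key : (s.+1 * kcount s.+1 G) ^ 2 <=
    kcount s G * (#|V| * kcount s.+1 G + s * (s.+2 * kcount s.+2 G)).
  rewrite -sum_degree_cliques; apply: leq_trans (sum_sqr_leq _ _) _.
  rewrite leq_mul2l; apply/orP; right.
  under eq_bigr do rewrite -mulnn -sum_nat_const.
  rewrite -(sum_facets s (fun C _ => #|common_nbrs C|)).
  apply: (@leq_trans (\sum_(A in cliques s.+1) (#|V| + s * #|common_nbrs A|))).
    by apply: leq_sum => A; apply: sum_facet_degrees.
  by rewrite big_split -big_distrr /= sum_degree_cliques sum_nat_const mulnC.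
rewrite /ordered_cliques !factS.
have := leq_mul (leqnn (s.+1 * s`! ^ 2)) key.
set F := s`!; set b := kcount _ _; set a := kcount _ _; set c := kcount _ _.
set N := #|V|; move=> H.
have -> : s.+1 * (s.+1 * F * b) ^ 2 = s.+1 * F ^ 2 * (s.+1 * b) ^ 2 by ring.
have -> : F * a * (N * (s.+1 * F * b) + s * (s.+2 * (s.+1 * F) * c)) =
  s.+1 * F ^ 2 * (a * (N * b + s * (s.+2 * c))) by ring.
exact: H.
Qed.

Lemma kcount0 : kcount 0 G = 1.
Proof.
rewrite /kcount -(cards1 (set0 : {set V})); congr #|pred_of_set _|.
apply/setP => S; rewrite !inE cards_eq0; case: eqP => //= ->.
by apply/cliqueP => x y; rewrite inE.
Qed.

End MoonMoser.

(** * Cliques of the Turan graph *)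

Section Turan.
Variables (n r : nat).
Hypothesis r_gt0 : 0 < r.

(** The vertices of any residue class missed by C are common neighbours of C. *)
Lemma turan_degree (C : {set 'I_n}) :
  (r - #|C|) * (n %/ r) <= #|common_nbrs (turan_graph n r) C|.
Proof.
pose res (i : 'I_n) : 'I_r := Ordinal (ltn_pmod i r_gt0).
have sub : \sum_(c in ~: (res @: C)) #|turan_part n c| <=
    #|common_nbrs (turan_graph n r) C|.
  under eq_bigr do rewrite -sum1_card big_mkcond /=.
  rewrite exchange_big /= -sum1_card [leqRHS]big_mkcond /=.
  apply: leq_sum => v _; rewrite -big_mkcondr sum1dep_card.
  case: ifPn => vC.
    apply/card_le1_eqP => a b.
    rewrite !inE => /andP[_ /eqP va] /andP[_ /eqP vb].
    by apply: val_inj; rewrite /= -va -vb.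
  rewrite leqn0 cards_eq0 -subset0; apply/subsetP => c; rewrite !inE.
  case/andP=> cC /eqP vc; case/negP: vC; apply/common_nbrsP => i iC /=.
  rewrite /turan_rel; apply: contraNneq cC => iv; apply/imsetP; exists i => //.
  by apply: val_inj; rewrite /= -vc iv.
apply: leq_trans sub.
apply: (@leq_trans (\sum_(c in ~: (res @: C)) (n %/ r))).
  rewrite sum_nat_const leq_mul2r [#|~: _|]cardsCs setCK card_ord.
  rewrite leq_sub2l ?orbT //.
  exact: leq_imset_card.
by apply: leq_sum => c _; rewrite card_turan_part leq_addr.
Qed.

Lemma turan_ordered_cliques t :
  (\prod_(i < t) (r - i)) * (n %/ r) ^ t <= ordered_cliques (turan_graph n r) t.
Proof.
elim: t => [|t IHt]; first by rewrite big_ord0 /ordered_cliques kcount0.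
rewrite big_ord_recr /= expnSr mulnACA.
apply: leq_trans (leq_mul IHt (leqnn _)) _.
rewrite /ordered_cliques factS [t.+1 * _]mulnC -!mulnA leq_mul2l.
rewrite -sum_degree_cliques -sum_nat_const leq_sum ?orbT // => C.
by rewrite inE => /andP[/eqP <- _]; apply: turan_degree.
Qed.
End Turan.

(** * Blowups from a positive density of cliques *)

Section Dense.
Variables (V : finType) (G : sgraph V).

(** The recursion follows the inductive step of [blowup_of_dense_tuples]: b
members in density 1/k are found among 4kb members in density 1/2k, and the
pigeonhole on the 2 ^ (4 k b) traces needs 2 ^ (8 k b) vertices. *)
Fixpoint blowup_exponent (r k : nat) : nat :=
  if r is r'.+1 then 4 * k * blowup_exponent r' (2 * k) + 8 * k else 0.

Definition clique_tuple r (t : r.-tuple V) : Prop :=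
  forall i i', i != i' -> adj G (tnth t i) (tnth t i').

Definition extensions r (M : {set r.+1.-tuple V}) (q : r.-tuple V) : {set V} :=
  [set v | [tuple of v :: q] \in M].

Lemma sum_extensions r (M : {set r.+1.-tuple V}) :
  #|M| = \sum_(q : r.-tuple V) #|extensions M q|.
Proof.
under eq_bigr do rewrite -sum1_card big_mkcond /=.
rewrite pair_big /= -sum1_card big_mkcond /=.
rewrite (reindex (fun p : r.-tuple V * V => [tuple of p.2 :: p.1])) /=.
  by apply: eq_bigr => p _; rewrite inE.
exists (fun t : r.+1.-tuple V => ([tuple of behead t], thead t))
  => [[q v] _ | t _] /=.
  by rewrite theadE; congr (_, _); apply: val_inj.
by rewrite [RHS]tuple_eta.
Qed.

(** The tuples with fewer than n/2k extensions account for at most half of M. *)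
Lemma popular_prefixes r k (M : {set r.+1.-tuple V}) :
  0 < #|V| -> #|V| ^ r.+1 <= k * #|M| ->
  #|V| ^ r <= 2 * k * #|[set q | #|V| <= 2 * k * #|extensions M q|]|.
Proof.
set n := #|V| => n_gt0 dM; set P := [set q | _].
have : 2 * k * #|M| <= 2 * k * #|P| * n + n ^ r.+1.
  rewrite sum_extensions (bigID (mem P)) /= mulnDr leq_add //.
    rewrite -[leqRHS]mulnA leq_mul2l -sum_nat_const leq_sum ?orbT // => q _.
    exact: max_card.
  rewrite big_distrr /=.
  apply: (@leq_trans (\sum_(q | q \notin P) n)).
    by apply: leq_sum => q; rewrite inE -ltnNge => /ltnW.
  rewrite sum_nat_const expnS mulnC leq_mul2l -card_tuple max_card orbT //.
move: dM; rewrite -(leq_pmul2r n_gt0) expnSr; nia.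
Qed.

(** A largest fiber of f on W is at least the average one. *)
Lemma pigeonhole_fiber (I J : finType) (W : {set I}) (f : I -> J) :
  0 < #|J| -> exists j, #|W| <= #|J| * #|[set i in W | f i == j]|.
Proof.
move=> /card_gt0P[j0 _].
pose fiber j := #|[set i in W | f i == j]|.
case: (@arg_maxnP J j0 predT fiber isT) => j _ jmax.
exists j; rewrite -sum1_card (partition_big f predT) //=.
rewrite -sum_nat_const leq_sum // => j' _; rewrite sum1dep_card; exact: jmax.
Qed.

Lemma injection_into (T : finType) (A : {set T}) b : b <= #|A| ->
  exists2 e : 'I_b -> T, injective e & forall j, e j \in A.
Proof.
move=> bA; exists (fun j => enum_val (widen_ord bA j)) => [j j' | j].
  by move=> /enum_val_inj/(congr1 val)/= /val_inj.
exact: enum_valP.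
Qed.

(** The pairs (v, j) such that v extends x j number at least B n / 2k = 2 b n.
Vertices with fewer than b such j account for at most half of them, so at least
n/4k vertices have a trace of size b or more.  Some trace T is shared by a
proportion 2^-B of these, which is at least b vertices since n >= 2^(2B). *)
Lemma common_trace r k b B (M : {set r.+1.-tuple V}) (x : 'I_B -> r.-tuple V) :
  0 < k -> 0 < b -> B = 4 * k * b -> 2 ^ (2 * B) <= #|V| ->
  (forall j, #|V| <= 2 * k * #|extensions M (x j)|) ->
  exists (T : {set 'I_B}) (W : {set V}), [/\ b <= #|T|, b <= #|W| &
    forall v j, v \in W -> j \in T -> [tuple of v :: x j] \in M].
Proof.
set n := #|V| => k_gt0 b_gt0 defB nB popx.
pose tr v := [set j | [tuple of v :: x j] \in M].
pose W := [set v | b <= #|tr v|].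
have n_gt0 : 0 < n by apply: leq_trans nB; rewrite expn_gt0.
have dc : \sum_v #|tr v| = \sum_j #|extensions M (x j)|.
  under eq_bigr do rewrite -sum1_card big_mkcond /=.
  rewrite exchange_big; apply: eq_bigr => j _ /=.
  by rewrite -sum1_card [RHS]big_mkcond; apply: eq_bigr => v _; rewrite !inE.
have lo : B * n <= 2 * k * \sum_v #|tr v|.
  rewrite dc big_distrr /= -{1}(card_ord B) -sum_nat_const; exact: leq_sum.
have hi : \sum_v #|tr v| <= #|W| * B + n * b.
  rewrite (bigID (mem W)) /= leq_add //.
    rewrite -sum_nat_const leq_sum // => v _.
    by rewrite -[leqRHS]card_ord max_card.
  apply: (@leq_trans (\sum_(v | v \notin W) b)).
    by apply: leq_sum => v; rewrite inE -ltnNge => /ltnW.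
  by rewrite sum_nat_const leq_mul2r max_card orbT.
have Wbig : n <= 4 * k * #|W|.
  have : 2 * k * b * n <= 2 * k * b * (4 * k * #|W|) by subst B; nia.
  by rewrite leq_pmul2l // !muln_gt0 k_gt0 b_gt0.
have [|T0 WT0] := @pigeonhole_fiber V {set 'I_B} W tr.
  by apply/card_gt0P; exists set0.
set W0 := [set _ in _ | _] in WT0.
have W0b : b <= #|W0|.
  rewrite leqNgt; apply/negP => W0b.
  move: WT0; rewrite -cardsT -powersetT card_powerset cardsT card_ord => WT0.
  have : n < 2 ^ B * 2 ^ B; last by rewrite -expnD addnn -mul2n ltnNge nB.
  apply: leq_ltn_trans Wbig _.
  apply: (@leq_ltn_trans (4 * k * b * 2 ^ B)); first by nia.
  by rewrite -defB ltn_pmul2r ?expn_gt0 // ltn_expl.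
exists T0, W0; split => //.
  have /card_gt0P[v] : 0 < #|W0| by apply: leq_trans W0b.
  by rewrite !inE => /andP[bv /eqP <-].
by move=> v j; rewrite !inE => /andP[_ /eqP <-]; rewrite inE.
Qed.

(** For fixed i, the vertices tnth (x j) i form the i-th part of a blowup.  That
each x j lies in M strengthens the induction: applied to the tuples with many
extensions, it yields a blowup along which new vertices can be found. *)
Lemma blowup_of_dense_tuples r k (M : {set r.-tuple V}) b :
  (forall t, t \in M -> clique_tuple t) ->
  #|V| ^ r <= k * #|M| -> 2 ^ (blowup_exponent r k * b) <= #|V| ->
  exists x : 'I_b -> r.-tuple V, [/\ forall j, x j \in M,
    forall i, injective (fun j => tnth (x j) i) &
    forall i i' j j', i != i' -> adj G (tnth (x j) i) (tnth (x j') i')].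
Proof.
elim: r k M b => [|r IHr] k M b clM dM Lb.
  have /card_gt0P[t tM] : 0 < #|M|.
    by move: dM; rewrite expn0 muln_gt0 => /andP[].
  by exists (fun=> t); split => // -[].
have [-> | b_gt0] := posnP b.
  have no0 : 'I_0 -> False by case.
  by exists (fun j => False_rect _ (no0 j));
    split => [j | i j | i i' j]; case: (no0 j).
have n_gt0 : 0 < #|V| by apply: leq_trans Lb; rewrite expn_gt0.
have k_gt0 : 0 < k.
  by move: dM; case: k {Lb} => //; rewrite mul0n leqn0 expn_eq0 eqn0Ngt n_gt0.
set B := 4 * k * b.
have clM' q :
  q \in [set q | #|V| <= 2 * k * #|extensions M q|] -> clique_tuple q.
  rewrite inE => popq i i' ii'.
  have /card_gt0P[v] : 0 < #|extensions M q|.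
    by apply: contraTT popq; rewrite -eqn0Ngt => /eqP->; rewrite muln0 -ltnNge.
  rewrite inE => /clM/(_ (lift ord0 i) (lift ord0 i')).
  by rewrite !tnthS (inj_eq lift_inj); apply.
have [| x [popx injx adjx]] := IHr _ _ B clM' (popular_prefixes n_gt0 dM).
  by apply: leq_trans Lb; rewrite leq_exp2l //= /B; nia.
have [||| T [W [bT bW TW]]] := @common_trace r k b B M x k_gt0 b_gt0.
- by [].
- by apply: leq_trans Lb; rewrite leq_exp2l //= /B; nia.
- by move=> j; move: (popx j); rewrite inE.
have [s s_inj sT] := injection_into bT; have [w w_inj wW] := injection_into bW.
exists (fun j => [tuple of w j :: x (s j)]); split=> [j | i j j' | i i' j j'].
- exact: TW.
- case: (unliftP ord0 i) => [i1 ->|->]; last by rewrite !tnth0 => /w_inj.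
  by rewrite !tnthS => /injx/s_inj.
- have cross j1 j2 i1 : adj G (w j1) (tnth (x (s j2)) i1).
    have /clM/(_ ord0 (lift ord0 i1)) := TW _ _ (wW j1) (sT j2).
    by rewrite tnth0 tnthS; apply.
  case: (unliftP ord0 i) => [i1 ->|->]; case: (unliftP ord0 i') => [i2 ->|->] //.
  + by rewrite (inj_eq lift_inj) !tnthS => /adjx.
  + by rewrite tnthS tnth0 adj_sym => _.
  + by rewrite tnthS tnth0 => _.
Qed.
End Dense.

Lemma large_blowup_of_many_cliques (V : finType) (G : sgraph V) s k b :
  #|V| ^ s <= k * kcount s G -> 2 ^ (blowup_exponent s k * b) <= #|V| ->
  contains G (blowup (complete_graph s) b).
Proof.
move=> many Vb.
pose M := [set t : s.-tuple V |
  [forall i, forall i', (i != i') ==> adj G (tnth t i) (tnth t i')]].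
have clM t : t \in M -> clique_tuple G t.
  rewrite inE => /forallP tM i i' ii'.
  by have /forallP/(_ i')/implyP := tM i; apply.
have kM : kcount s G <= #|M|.
  rewrite /kcount.
  apply: leq_trans (leq_imset_card (fun t : s.-tuple V => [set x in t]) M).
  apply/subset_leq_card/subsetP => S; rewrite inE => /andP[sS /cliqueP clS].
  have sz : size (enum S) == s by rewrite -cardE.
  apply/imsetP; exists (Tuple sz); last by apply/setP => x; rewrite inE mem_enum.
  rewrite inE; apply/forallP => i; apply/forallP => i'; apply/implyP => ii'.
  have tS j : tnth (Tuple sz) j \in S by rewrite -mem_enum; apply: mem_tnth.
  apply: clS => //; apply: contraNneq ii' => /tuple_uniqP -> //.
  exact: enum_uniq.
have [|x [_ injx adjx]] := @blowup_of_dense_tuples V G s k M b clM _ Vb.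
  by apply: leq_trans many _; rewrite leq_mul2l kM orbT.
exists (fun p => tnth (x p.2) p.1) => [[i j] [i' j'] /= | [i j] [i' j'] /= ii'].
  have [-> /injx-> // | ii' e] := eqVneq i i'.
  by have := adjx _ _ j j' ii'; rewrite e adj_irr.
exact: adjx.
Qed.

(** * Supersaturation *)

Local Open Scope ring_scope.

Section Growth.
Variables (R : realType) (V : finType) (G : sgraph V).

Local Notation h s := ((ordered_cliques G s)%:R : R).
Local Notation N := (#|V|%:R : R).

(** In a complete r-partite graph with equal parts this is an equality for
a = 1/r; a smaller slope a is a stronger condition. *)
Definition fast_growth (a : R) s := N * (1 - s%:R * a) * h s <= h s.+1.

(** After division by h s and h s.+1, Moon-Moser reads
s (h_(s+2) / h_(s+1)) >= (s+1) (h_(s+1) / h_s) - N, and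
(s+1) (1 - s a) - 1 = s (1 - (s+1) a). *)
Lemma moon_moser_growth a s : (0 < s)%N -> fast_growth a s -> fast_growth a s.+1.
Proof.
rewrite /fast_growth => s_gt0 Ps.
have mm : s.+1%:R * h s.+1 ^+ 2 <= h s * (N * h s.+1 + s%:R * h s.+2).
  by have := moon_moser G s; rewrite -(ler_nat R) !(natrM, natrD, natrX).
have s_gt0R : 0 < s%:R :> R by rewrite ltr0n.
(* When h s or h s.+1 vanishes there is no ratio to speak of, but then
   h s.+1 = 0, by Moon-Moser in the first case, and the claim is trivial. *)
have := ler0n R (ordered_cliques G s.+1); rewrite le_eqVlt => /predU1P[e|h1].
  by rewrite -e mulr0 ler0n.
have := ler0n R (ordered_cliques G s); rewrite le_eqVlt => /predU1P[e|h0].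
  have : 0 < s.+1%:R * h s.+1 ^+ 2 by rewrite mulr_gt0 ?ltr0n ?exprn_gt0.
  by move: mm; rewrite -e mul0r => /le_lt_trans/[apply]; rewrite ltxx.
rewrite -(ler_pM2l (mulr_gt0 s_gt0R h0)).
move: mm Ps; rewrite -natr1.
move: (h s) (h s.+1) (h s.+2) h0 h1 => x y z x0 y0 mm Ps.
have : 0 <= y * (s%:R + 1) * (y - N * (1 - s%:R * a) * x).
  by rewrite mulr_ge0 ?subr_ge0 // mulr_ge0 ?addr_ge0 // ltW.
lra.
Qed.

Lemma fast_growth_mono a s u : (0 < s <= u)%N -> fast_growth a s -> fast_growth a u.
Proof.
elim: u => [|u IHu] /andP[s0]; first by rewrite leqNgt s0.
rewrite leq_eqVlt => /predU1P[-> //|]; rewrite ltnS => su Ps.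
by apply: moon_moser_growth; [exact: leq_trans s0 su | apply: IHu; rewrite ?s0].
Qed.

Lemma slow_growth_bound a t :
  (forall s, (s < t)%N -> 0 <= 1 - s%:R * a) ->
  (forall s, (0 < s < t)%N -> ~~ fast_growth a s) ->
  h t <= \prod_(s < t) (N * (1 - s%:R * a)).
Proof.
elim: t => [|t IHt] a0 slow.
  by rewrite big_ord0 /ordered_cliques kcount0.
rewrite big_ord_recr /= mulrC.
have ht : h t <= \prod_(s < t) (N * (1 - s%:R * a)).
  apply: IHt => [s st | s /andP[s0 st]]; first exact/a0/leqW.
  by apply: slow; rewrite s0 leqW.
apply: le_trans (ler_wpM2l _ ht); last by rewrite mulr_ge0 ?a0.
(* The factor for s = 0 is N, and h 1 <= N is Moon-Moser at 0. *)
have [t0|t0] := posnP t; last first.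
  by have := slow t; rewrite t0 ltnSn -ltNge => /(_ isT)/ltW.
have := moon_moser G 0; rewrite t0 mul0r subr0 mulr1 addn0 mul1n -natrM ler_nat.
have -> : ordered_cliques G 0 = 1%N by rewrite /ordered_cliques kcount0.
rewrite muln1; have [-> // | h1] := posnP (ordered_cliques G 1).
by rewrite mul1n -mulnn leq_pmul2r.
Qed.

(** If fast growth failed at every 0 < s < t, the ratios would multiply to less
than h t; and once it holds, it persists. *)
Lemma fast_growth_of_many_cliques a t u :
  (forall s, (s < t)%N -> 0 <= 1 - s%:R * a) ->
  \prod_(s < t) (N * (1 - s%:R * a)) < h t -> (t <= u)%N -> fast_growth a u.
Proof.
move=> a0 big_h tu; have [/existsP[s /andP[s0 Ps]] | noP] :=
    boolP [exists s : 'I_t, (0 < s)%N && fast_growth a s].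
  by apply: fast_growth_mono Ps; rewrite s0 (leq_trans (ltnW (ltn_ord s)) tu).
move: big_h; rewrite ltNge slow_growth_bound // => s /andP[s0 st].
by apply: contra noP => Ps; apply/existsP; exists (Ordinal st); rewrite /= s0.
Qed.

Lemma geometric_growth a c t u : 0 <= c -> (t <= u)%N ->
  (forall s, (t <= s < u)%N -> c <= 1 - s%:R * a /\ fast_growth a s) ->
  (c * N) ^+ (u - t) * h t <= h u.
Proof.
move=> c0; elim: u => [|u IHu].
  by rewrite leqn0 => /eqP-> _; rewrite expr0 mul1r.
rewrite leq_eqVlt => /predU1P[-> _ |]; first by rewrite subnn expr0 mul1r.
rewrite ltnS => tu fast; have [|ca Pu] := fast u; first by rewrite tu ltnSn.
apply: le_trans Pu; rewrite subSn // exprS -mulrA.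
apply: (@le_trans _ _ (c * N * h u)).
  rewrite ler_wpM2l ?mulr_ge0 // IHu // => s /andP[ts su].
  by apply: fast; rewrite ts leqW.
by rewrite [c * N]mulrC ler_wpM2r // ler_wpM2l.
Qed.
End Growth.

(** Taking 1 + d to be the (m+1)-st root of 1 + eps makes its m-th power strictly
smaller than 1 + eps. *)
Lemma exists_small_growth (R : realType) m (eps : R) : 0 < eps ->
  exists2 d : R, 0 < d & (1 + d) ^+ m < 1 + eps.
Proof.
move=> e0; have e1 : 1 < 1 + eps by rewrite ltrDl.
pose u := expR (ln (1 + eps) / m.+1%:R).
have u1 : 1 < u by rewrite expR_gt1 divr_gt0 ?ln_gt0.
exists (u - 1); first by rewrite subr_gt0.
have <- : u ^+ m.+1 = 1 + eps.
  by rewrite -expRM_natr divfK ?pnatr_eq0 // lnK // posrE (lt_trans _ e1).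
by rewrite addrC subrK ltr_eXn2l.
Qed.

Section Supersaturation.
Variables (R : realType) (r : nat) (d : R).
Hypotheses (r_gt0 : (0 < r)%N) (d_gt0 : 0 < d).

(** The Turan slope 1/r, lowered a little: enough to gain at s = r
([slope_ge]), but little enough to lose only a factor 1 + d against the Turan
ratio (r - s) / r for s < r ([slope_le]). *)
Let a : R := r%:R^-1 - d / r%:R ^+ 2.

Lemma slope_ge s : (s <= r)%N -> s%:R * d / r%:R ^+ 2 <= 1 - s%:R * a.
Proof.
move=> sr; rewrite /a.
have r0 : 0 < r%:R :> R by rewrite ltr0n.
have sr1 : s%:R / r%:R <= 1 :> R by rewrite ler_pdivrMr // mul1r ler_nat.
lra.
Qed.

Lemma slope_le s : (s < r)%N -> r%:R * (1 - s%:R * a) <= (1 + d) * (r - s)%N%:R.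
Proof.
move=> sr; rewrite /a natrB 1?ltnW //.
have r0 : 0 < r%:R :> R by rewrite ltr0n.
have -> : r%:R * (1 - s%:R * (r%:R^-1 - d / r%:R ^+ 2)) =
    r%:R - s%:R + s%:R / r%:R * d.
  by field; rewrite gt_eqF.
have sr1 : s%:R / r%:R <= 1 :> R by rewrite ler_pdivrMr // mul1r ler_nat ltnW.
have rs1 : 1 <= r%:R - s%:R :> R by rewrite -natrB 1?ltnW // ler1n subn_gt0.
rewrite [(1 + d) * _]mulrDl mul1r lerD2l [d * _]mulrC ler_pM2r //.
exact: le_trans sr1 rs1.
Qed.

(** Two factors 1 + d are lost at each of the t steps, one to the lowered slope
and one to the rounding in N %/ r; the hypotheses on d and N keep the total loss
below 1 + eps.  The lower bound is independent of t, which makes the constant of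
the theorem uniform in t. *)
Lemma many_cliques (V : finType) (G : sgraph V) (eps : R) t : (0 < t)%N ->
  (1 + d) ^+ (2 * r) < 1 + eps -> r%:R <= d * (r * (#|V| %/ r))%:R ->
  (t <= r)%N ->
  (1 + eps) * (kcount t (turan_graph #|V| r))%:R <= (kcount t G)%:R ->
  (Num.min (d / r%:R ^+ 2) (2 * r%:R)^-1 * #|V|%:R) ^+ r.+1 <=
  (ordered_cliques G r.+1)%:R.
Proof.
set N := #|V|; set q := (N %/ r)%N => t_gt0 d_eps q_large tr dense.
have r0 : 0 < r%:R :> R by rewrite ltr0n.
have rq_gt0 : 0 < (r * q)%N%:R :> R.
  by rewrite -(pmulr_rgt0 _ d_gt0) (lt_le_trans r0).
have q_gt0 : (0 < q)%N by move: rq_gt0; rewrite ltr0n muln_gt0 r_gt0.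
have Nq : (N <= r * q + r)%N.
  by rewrite mulnC {1}(divn_eq N r) leq_add2l ltnW // ltn_pmod.
have NqR : N%:R <= (1 + d) * (r * q)%N%:R :> R.
  apply: (@le_trans _ _ (r * q + r)%N%:R); first by rewrite ler_nat.
  by rewrite natrD mulrDl mul1r lerD2l.
have turan : (\prod_(s < t) (r - s)%N%:R) * q%:R ^+ t <=
    (ordered_cliques (turan_graph N r) t)%:R :> R.
  by rewrite -natr_prod -natrX -natrM ler_nat turan_ordered_cliques.
have eps0 : 0 < 1 + eps.
  by apply: lt_trans d_eps; rewrite exprn_gt0 // addr_gt0.
have ht : (1 + eps) * ((\prod_(s < t) (r - s)%N%:R) * q%:R ^+ t) <=
    (ordered_cliques G t)%:R.
  apply: le_trans (ler_wpM2l (ltW eps0) turan) _.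
  by rewrite /ordered_cliques !natrM mulrCA ler_wpM2l.
have prod_gt0 : 0 < (\prod_(s < t) (r - s)%N%:R) * q%:R ^+ t :> R.
  rewrite mulr_gt0 ?exprn_gt0 ?ltr0n // prodr_gt0 // => s _.
  by rewrite ltr0n subn_gt0 (leq_trans (ltn_ord s)).
have slope0 s : (s <= r)%N -> 0 <= 1 - s%:R * a.
  move=> /slope_ge; apply: le_trans.
  by rewrite divr_ge0 ?exprn_ge0 ?mulr_ge0 // ltW.
have big_h : \prod_(s < t) (N%:R * (1 - s%:R * a)) < (ordered_cliques G t)%:R.
  apply: lt_le_trans ht.
  apply: (@le_lt_trans _ _ ((1 + d) ^+ (2 * t) *
      (\prod_(s < t) (r - s)%N%:R * q%:R ^+ t))); last first.
    rewrite ltr_pM2r // (le_lt_trans _ d_eps) // ler_weXn2l ?leq_mul2l ?tr //.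
    by rewrite lerDl ltW.
  have constE (x : R) : x ^+ t = \prod_(s < t) x by rewrite prodr_const card_ord.
  rewrite exprM !constE -!big_split /=; apply: ler_prod => s _.
  have sr : (s < r)%N := leq_trans (ltn_ord s) tr.
  rewrite mulr_ge0 ?slope0 1?ltnW //=.
  apply: le_trans (ler_wpM2r (slope0 _ (ltnW sr)) NqR) _.
  rewrite natrM; have := slope_le sr; move: (1 - _) => x le_x.
  have -> : (1 + d) * (r%:R * q%:R) * x = (1 + d) * q%:R * (r%:R * x) by ring.
  have -> : (1 + d) ^+ 2 * ((r - s)%N%:R * q%:R) =
      (1 + d) * q%:R * ((1 + d) * (r - s)%N%:R) by ring.
  by rewrite ler_wpM2l // mulr_ge0 // addr_ge0 // ltW.
set c := Num.min _ _.
have c_gt0 : 0 < c by rewrite lt_min divr_gt0 ?exprn_gt0 // invr_gt0 mulr_gt0.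
have fast : (c * N%:R) ^+ (r.+1 - t) * (ordered_cliques G t)%:R <=
    (ordered_cliques G r.+1)%:R.
  apply: (@geometric_growth _ _ _ a); rewrite ?(ltW c_gt0) ?leqW //.
  move=> s /andP[ts sr].
  split; last first.
    apply: fast_growth_of_many_cliques ts => // s' s't.
    exact/slope0/ltnW/(leq_trans s't).
  apply: le_trans (slope_ge sr); apply: (@le_trans _ _ (d / r%:R ^+ 2)).
    by rewrite ge_min lexx.
  rewrite -mulrA ler_peMl ?divr_ge0 ?exprn_ge0 ?ler1n ?(ltW d_gt0) //.
  exact: leq_trans t_gt0 ts.
apply: le_trans fast; rewrite -[in leLHS](subnK (leqW tr)) exprD ler_wpM2l //.
  by rewrite exprn_ge0 // mulr_ge0 // ltW.
apply: le_trans ht.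
have cNq : c * N%:R <= q%:R.
  apply: (@le_trans _ _ ((2 * r%:R)^-1 * N%:R)).
    by rewrite ler_wpM2r // ge_min lexx orbT.
  rewrite mulrC ler_pdivrMr ?mulr_gt0 // -!natrM ler_nat.
  by apply: leq_trans Nq _; nia.
apply: (@le_trans _ _ (q%:R ^+ t)).
  by rewrite lerXn2r // ?nnegrE // mulr_ge0 // ltW.
rewrite mulrA ler_peMl ?exprn_ge0 // mulr_ege1 //.
  by rewrite (le_trans _ (ltW d_eps)) // exprn_ege1 // lerDl ltW.
rewrite -natr_prod ler1n prodn_gt0 // => s.
by rewrite subn_gt0 (leq_trans (ltn_ord s)).
Qed.
End Supersaturation.

Theorem theorem1p6 (R : realType) (r : nat) (hr : (2 <= r)%N)
    (eps : R) (heps : 0 < eps) :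
  exists C : R, 0 < C /\
    forall t : nat, (2 <= t <= r)%N ->
    exists n0 : nat, forall (n : nat) (V : finType) (G : sgraph V),
      #|V| = n -> (n0 <= n)%N ->
      (1 + eps) * (kcount t (turan_graph n r))%:R <= (kcount t G)%:R ->
      exists b : nat, [/\ (0 < b)%N, C * ln n%:R <= b%:R &
        contains G (blowup (complete_graph r.+1) b)].
Proof.
have [d d0 d_eps] := exists_small_growth (2 * r) heps.
have r0 : (0 < r)%N := ltnW hr.
have r0R : 0 < r%:R :> R by rewrite ltr0n.
set c := Num.min (d / r%:R ^+ 2) (2 * r%:R)^-1.
have c0 : 0 < c by rewrite lt_min divr_gt0 ?exprn_gt0 // invr_gt0 mulr_gt0.
pose k := Num.bound ((c ^+ r.+1)^-1 * (r.+1)`!%:R).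
pose L := (blowup_exponent r.+1 k).+1.
have ln2 : 0 < ln (2 : R) by rewrite ln_gt0 // ltr1n.
have L2 : 0 < (2 * L)%N%:R * ln (2 : R) by rewrite mulr_gt0 // ltr0n.
exists ((2 * L)%N%:R * ln 2)^-1; split; first by rewrite invr_gt0.
move=> t /andP[t2 tr].
exists (2 ^ L + r * (Num.bound (r%:R / d)).+1)%N => n V G defn n_large dense.
have n_gt0 : (0 < n)%N.
  by apply: leq_trans n_large; rewrite addn_gt0 expn_gt0.
pose b := (trunc_log 2 n %/ L)%N.
have b_gt0 : (0 < b)%N.
  rewrite divn_gt0 // trunc_log_max //; apply: leq_trans n_large; exact: leq_addr.
have Lb : (2 ^ (L * b) <= n)%N.
  apply: leq_trans (trunc_logP (isT : (1 < 2)%N) n_gt0).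
  by rewrite leq_exp2l // mulnC leq_trunc_div.
(* b > 0 absorbs both roundings, of the logarithm and of the quotient by L. *)
have nLb : (n <= 2 ^ (2 * L * b))%N.
  apply: leq_trans (ltnW (trunc_log_ltn n (isT : (1 < 2)%N))) _.
  rewrite leq_exp2l //.
  apply: leq_trans (ltn_ceil (trunc_log 2 n) (isT : (0 < L)%N)) _.
  by rewrite -/b; nia.
exists b; split=> //.
  rewrite mulrC ler_pdivrMr // mulrA -natrM mulr_natl.
  rewrite -lnXn // -natrX ler_ln ?posrE ?ltr0n ?expn_gt0 // ler_nat.
  by rewrite [(b * _)%N]mulnC.
apply: (@large_blowup_of_many_cliques _ _ _ k); last first.
  by rewrite defn (leq_trans _ Lb) // leq_exp2l // leq_mul2r leqnSn orbT.
have q_large : r%:R <= d * (r * (#|V| %/ r))%N%:R.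
  rewrite mulrC -ler_pdivrMr // ltW // (lt_le_trans (archi_boundP _)) //.
    by rewrite divr_ge0 // ltW.
  rewrite ler_nat defn; apply: leq_trans (leq_pmull _ r0).
  rewrite leq_divRL // mulnC (leq_trans _ n_large) //.
  by rewrite (leq_trans _ (leq_addl _ _)) // leq_mul2l leqnSn orbT.
subst n; have := many_cliques r0 d0 (ltnW t2) d_eps q_large tr dense.
rewrite -/c exprMn [_ * _ ^+ _]mulrC -ler_pdivlMr ?exprn_gt0 // => many.
rewrite -(ler_nat R) natrX (le_trans many) // /ordered_cliques.
rewrite [in leLHS]natrM [in leRHS]natrM mulrC mulrA.
rewrite ler_wpM2r // ltW // /k archi_boundP // mulr_ge0 // invr_ge0.
by rewrite exprn_ge0 // ltW.
Qed.
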